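(* Let $W$ be a binary erasure channel with erasure probability $z\in[0,1]$, and let $\varepsilon\in(0,1)$ be such that $n:=-5\log_2\varepsilon$ is a positive integer. Let $\mathcal T$ be the channel tree generated from the root $W$ by the rule: apply the channel transformation $T$ to a vertex $w$ (i.e. give $w$ the two children $w^\flat$ and $w^\sharp$) if and only if $\operatorname{depth}(w)<n$ and $Y(w)>\varepsilon 2^{-n}$. Let $\mathcal A$ be the set of vertices defined by: $w\in\mathcal A$ if and only if $w$ is a leaf of $\mathcal T$ and $Z(w)\le\varepsilon2^{-n}$. Then the block error probability $P$ of the code $(\mathcal T,\mathcal A)$ satisfies $P\le\varepsilon$.
   Context: For a binary erasure channel $w$, let $Z(w)\in[0,1]$ denote its erasure probability (its Bhattacharyya parameter) and $Y(w)=\min\{Z(w),1-Z(w)\}$. The channel transformation $T$ turns two independent copies of $w$ into one copy of $w^\flat$ and one copy of $w^\sharp$, which are binary erasure channels with $Z(w^\flat)=1-(1-Z(w))^2$ and $Z(w^\sharp)=Z(w)^2$. A channel tree is a finite rooted full binary tree (each vertex has zero or two children) whose vertices are labelled by channels, such that the children of every non-leaf vertex $w$ are $w^\flat$ and $w^\sharp$. The root has depth $0$; $\operatorname{depth}(w)$ is the distance of $w$ from the root; the depth of a tree is the depth of its deepest leaf. Different vertices are regarded as distinct even if their labels have equal erasure probabilities. A channel tree $\mathcal T$ with root $W$ together with a set $\mathcal A$ of leaves determines a block code of length $N=2^{\operatorname{depth}(\mathcal T)}$, as follows. For a vertex $w$ put $m_w=2^{\operatorname{depth}(\mathcal T)-\operatorname{depth}(w)}$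 (the number of copies of $w$ in the circuit). Encoder: each vertex $w$ is assigned a word $x_w\in\mathbb F_2^{m_w}$. If $w$ is a leaf in $\mathcal A$, $x_w$ consists of $m_w$ arbitrary information bits; if $w$ is a leaf not in $\mathcal A$, $x_w=0$; if $w$ is not a leaf, then $x_w=(u+v,v)$ with $u=x_{w^\flat}$ and $v=x_{w^\sharp}$. The word $x_W$ at the root is transmitted over $N$ independent uses of $W$; each symbol is independently replaced by the erasure symbol $?$ with probability $z$ and received unchanged otherwise. Decoder (successive cancellation): at vertex $w$ the decoder takes an input in $\{0,1,?\}^{m_w}$ and returns a word $\hat x_w\in\mathbb F_2^{m_w}$; the root takes the received word. If $w$ is a leaf not in $\mathcal A$, it returns $0$. If $w$ is a leaf in $\mathcal A$, it declares a block error if its input contains a $?$, and otherwise returns its input. If $w$ is not a leaf, with input $(y',y'')$ split into two halves, it first decodes at $w^\flat$ with input $y'-y''$ and obtains $\hat u$, then decodes at $w^\sharp$ with input $(y'-\hat u)\vee y''$ and obtains $\hat v$, and returns $(\hat u+\hat v,\hat v)$. Operations are coordinatewise; subtraction involving $?$ gives $?$, and $a\vee b$ is a non-$?$ operand if there is one and $?$ otherwise. The block error probability $P$ is the probability that a block error is declared or that some information bit is not recovered correctly, i.e. that at least one copy of a leaf channel in $\mathcal A$ fails to transmit its bit. *)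

(* Defs.v *)
(* MathComp / MathComp-Analysis *)
From HB Require Import structures.
From mathcomp Require Import all_boot all_order all_algebra.
From mathcomp Require Import reals exp.
Set Implicit Arguments.
Unset Strict Implicit.
Unset Printing Implicit Defensive.
Import Order.TTheory GRing.Theory Num.Theory.
Local Open Scope ring_scope.

(* A binary erasure channel is determined by its erasure probability. *)
Record bec (R : realType) := Bec { Z : R; Z01 : 0 <= Z <= 1 }.

Definition Y (R : realType) (w : bec R) : R := Num.min (Z w) (1 - Z w).

(* The output alphabet {0, 1, ?} is option 'F_2, with None for ?. *)
Definition transition (R : realType) (w : bec R)
    (a : 'F_2) (o : option 'F_2) : R :=
  if o is Some a' then (1 - Z w) *+ (a' == a) else Z w.

Lemma flat_subproof (R : realType) (w : bec R) :
  0 <= 1 - (1 - Z w) ^+ 2 <= 1.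
Proof.
have /andP[z0 z1] := Z01 w.
by rewrite subr_ge0 gerBl sqr_ge0 andbT exprn_ile1 ?subr_ge0 // gerBl.
Qed.

Lemma sharp_subproof (R : realType) (w : bec R) : 0 <= Z w ^+ 2 <= 1.
Proof. by have /andP[z0 z1] := Z01 w; rewrite sqr_ge0 exprn_ile1. Qed.

Definition flat (R : realType) (w : bec R) : bec R := Bec (flat_subproof w).
Definition sharp (R : realType) (w : bec R) : bec R := Bec (sharp_subproof w).

Inductive tree (R : realType) : Type :=
| Leaf of bec R
| Node of bec R & tree R & tree R.

(* A vertex is the path leading to it from the root: false goes to the first
   (flat) child, true to the second (sharp) child.  So the depth of a vertex p
   is size p, and vertices with equal labels remain distinct. *)
Definition vertex := seq bool.

Definition root (R : realType) (t : tree R) : bec R :=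
  match t with Leaf w => w | Node w _ _ => w end.

Fixpoint depth (R : realType) (t : tree R) : nat :=
  if t is Node _ l r then (maxn (depth l) (depth r)).+1 else 0%N.

Fixpoint vertices (R : realType) (t : tree R) : seq vertex :=
  [::] :: if t is Node _ l r then
            map (cons false) (vertices l) ++ map (cons true) (vertices r)
          else [::].

Fixpoint leaves (R : realType) (t : tree R) : seq vertex :=
  if t is Node _ l r then
    map (cons false) (leaves l) ++ map (cons true) (leaves r)
  else [:: [::]].

(* Only meaningful for p \in vertices t. *)
Fixpoint label (R : realType) (t : tree R) (p : vertex) : bec R :=
  match p, t with
  | c :: p', Node _ l r => label (if c then r else l) p'
  | _, _ => root t
  end.

Fixpoint channel_tree (R : realType) (t : tree R) : Prop :=
  if t is Node w l r then
    [/\ root l = flat w, root r = sharp w, channel_tree l & channel_tree r]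
  else True.

(* [rule d w] tells whether a vertex of depth d labelled w gets children. *)
Definition generated_from (R : realType) (W : bec R)
    (rule : nat -> bec R -> bool) (t : tree R) : Prop :=
  [/\ channel_tree t, root t = W &
      forall p, p \in vertices t ->
        (p \notin leaves t) = rule (size p) (label t p)].

(* word S k is the type of words of length 2 ^ k over S; the length is a
   fixpoint so that such a word splits into halves without a cast. *)
Fixpoint pow2 (k : nat) : nat := if k is k'.+1 then (pow2 k' + pow2 k')%N else 1%N.

Lemma pow2E k : pow2 k = (2 ^ k)%N.
Proof. by elim: k => //= k ->; rewrite addnn -mul2n expnS. Qed.

Notation word S k := 'rV[S]_(pow2 k).

(* The information bits: b w i is the i-th bit carried by the leaf w. *)
Definition message := vertex -> nat -> 'F_2.

Definition below (S : Type) (c : bool) (f : vertex -> S) : vertex -> S :=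
  fun p => f (c :: p).

(* The word x at the root of t, when t is the subtree at a vertex w with
   k = depth of the whole tree - depth of w; A and b are relative to w.  The
   case of a Node with k = 0 does not arise, as depth t <= k. *)
Fixpoint encode (R : realType) (t : tree R) (k : nat) (A : pred vertex)
    (b : message) : word 'F_2 k :=
  match t with
  | Leaf _ => if A [::] then \row_i b [::] i else 0
  | Node _ l r =>
    match k return word 'F_2 k with
    | 0%N => 0
    | k'.+1 =>
      let u := encode l k' (below false A) (below false b) in
      let v := encode r k' (below true A) (below true b) in
      row_mx (u + v) v
    end
  end.

Definition erased_sub (a b : option 'F_2) : option 'F_2 :=
  if (a, b) is (Some a', Some b') then Some (a' - b') else None.

Definition erased_or (a b : option 'F_2) : option 'F_2 :=
  if a is Some _ then a else b.

Definition merge_messages (bu bv : message) : message :=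
  fun p => match p with
           | false :: p' => bu p'
           | true :: p' => bv p'
           | [::] => fun=> 0
           end.

(* None means that a block error has been declared; otherwise the result
   consists of the estimated information bits and the estimated word.
   Same conventions on k and A as for encode. *)
Fixpoint decode (R : realType) (t : tree R) (k : nat) (A : pred vertex) :
    word (option 'F_2) k -> option (message * word 'F_2 k) :=
  match t with
  | Leaf _ => fun y =>
    if A [::] then
      if [exists i, y 0 i == None] then None
      else let x := map_mx (odflt 0) y in
           Some (fun=> fun i => oapp (x 0) 0 (insub i), x)
    else Some (fun=> fun=> 0, 0)
  | Node _ l r =>
    match k return word (option 'F_2) k -> option (message * word 'F_2 k) with
    | 0%N => fun=> None
    | k'.+1 => fun y =>
      let y1 := lsubmx y in
      let y2 := rsubmx y in
      if decode l (below false A) (map2_mx erased_sub y1 y2) is Some (bu, u)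
      then
        let y1u := map2_mx erased_sub y1 (map_mx Some u) in
        if decode r (below true A) (map2_mx erased_or y1u y2) is Some (bv, v)
        then Some (merge_messages bu bv, row_mx (u + v) v)
        else None
      else None
    end
  end.

(* The event that, on received word y, an error is declared or some of the
   information bits b is not recovered correctly. *)
Definition block_error (R : realType) (t : tree R) (A : pred vertex)
    (b : message) (y : word (option 'F_2) (depth t)) : bool :=
  if decode t A y is Some (b', _) then
    has (fun w => A w &&
          [exists i : 'I_(2 ^ (depth t - size w)%N), b' w i != b w i]) (leaves t)
  else true.

(* The block error probability when the information bits are b. *)
Definition block_error_prob (R : realType) (t : tree R) (A : pred vertex)
    (b : message) : R :=
  \sum_(y : word (option 'F_2) (depth t) | block_error A b y)
    \prod_i transition (root t) (encode t (depth t) A b 0 i) (y 0 i).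

Section Existence.
Variables (R : realType) (rule : nat -> bec R -> bool).

Fixpoint grow (fuel d : nat) (w : bec R) : tree R :=
  if fuel is f.+1 then
    if rule d w then Node w (grow f d.+1 (flat w)) (grow f d.+1 (sharp w))
    else Leaf w
  else Leaf w.

Lemma root_grow f d w : root (grow f d w) = w.
Proof. by case: f => //= f; case: ifP. Qed.

Lemma mem_cons_map c (p : vertex) (s1 s2 : seq vertex) :
  (c :: p \in map (cons false) s1 ++ map (cons true) s2) =
  (p \in if c then s2 else s1).
Proof.
have inj a : injective (@cons bool a) by move=> ? ? [].
have out a a' (s : seq vertex) : a != a' -> a :: p \in map (cons a') s = false.
  by move=> ne; apply/mapP => -[q _ [e _]]; rewrite e eqxx in ne.
by rewrite mem_cat; case: c; rewrite (mem_map (inj _)) out ?orbF.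
Qed.

Lemma grow_generated f d w n : (forall d' w', rule d' w' -> (d' < n)%N) ->
    (n <= d + f)%N ->
  channel_tree (grow f d w) /\
  forall p, p \in vertices (grow f d w) ->
    (p \notin leaves (grow f d w)) =
    rule (d + size p)%N (label (grow f d w) p).
Proof.
move=> ltn; elim: f d w => [|f IH] d w le_n /=.
  split=> // p; rewrite inE => /eqP-> /=; rewrite addn0.
  apply/esym/negP => /ltn; rewrite addn0 in le_n.
  by rewrite ltnNge le_n.
case: ifPn => [rdw|/negPf rdw]; last first.
  by split=> // p; rewrite inE => /eqP->; rewrite addn0 /= rdw.
have le_n' : (n <= d.+1 + f)%N by rewrite addSnnS.
have [c1 g1] := IH d.+1 (flat w) le_n'; have [c2 g2] := IH d.+1 (sharp w) le_n'.
split; first by split; rewrite ?root_grow.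
case=> [_|c p]; first by rewrite addn0 /= rdw mem_cat; apply/norP; split; apply/mapP => -[].
rewrite /= inE /= !mem_cons_map addnS -addSn.
by case: c => ?; [exact: g2|exact: g1].
Qed.

(* A rule that stops at some depth n does generate a tree. *)
Lemma generated_from_exists (W : bec R) n :
  (forall d w, rule d w -> (d < n)%N) -> exists t, generated_from W rule t.
Proof.
move=> ltn; exists (grow n 0 W).
by have [] := @grow_generated n 0 W n ltn (leqnn _); split=> //; exact: root_grow.
Qed.

End Existence.

(* Main.v *)
(* Give the decoder the correct word at every first child.  At each vertex w it
   then sees independent uses of w, and it agrees with the true decoder as long
   as it does not fail, so the union bound over all copies of leaves in A
   applies.  Each contributes at most eps 2^-n, and there are at most
   2^depth(T) <= 2^n copies. *)
Require Import Defs.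
From HB Require Import structures.
From mathcomp Require Import all_boot all_order all_algebra.
From mathcomp Require Import reals exp.
From mathcomp Require Import ring.
Set Implicit Arguments.
Unset Strict Implicit.
Unset Printing Implicit Defensive.
Import Order.TTheory GRing.Theory Num.Theory.
Local Open Scope ring_scope.

(** The sent word [x] and the channel [w] are parameters so that the same notion serves at every
    vertex; [block_error_prob] unfolds to the instance at the root. *)
Definition prob (R : realType) (w : bec R) (m : nat) (x : 'rV['F_2]_m)
    (E : pred 'rV[option 'F_2]_m) : R :=
  \sum_(y | E y) \prod_i transition w (x 0 i) (y 0 i).

(** * One symbol through the channel transformation *)

Lemma transition_ge0 (R : realType) (w : bec R) a o : 0 <= transition w a o.
Proof.
have /andP[z0 z1] := Z01 w.
by case: o => //= a'; rewrite mulrn_wge0 // subr_ge0.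
Qed.

Lemma transitionE (R : realType) (w : bec R) a o :
  transition w a o = Z w * (None == o)%:R + (1 - Z w) * (Some a == o)%:R.
Proof.
case: o => [a'|] /=; last by rewrite mulr1 mulr0 addr0.
by rewrite mulr0 add0r mulr_natr eq_sym.
Qed.

Lemma sum_transition (R : realType) (w : bec R) a (g : option 'F_2 -> R) :
  \sum_o transition w a o * g o = Z w * g None + (1 - Z w) * g (Some a).
Proof.
rewrite (bigD1 None) //= (bigD1 (Some a)) //= eqxx mulr1n big1 ?addr0 //.
move=> [a'|] //= /eqP ne; rewrite (_ : a' == a = false) ?mul0r //.
by apply/eqP => e; apply: ne; rewrite e.
Qed.

(** Each symbol is either erased or correct, so only four pairs of outputs have to be inspected. *)
Lemma sum_transition2 (R : realType) (w : bec R) a1 a2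
    (f : option 'F_2 -> option 'F_2 -> option 'F_2) c :
  \sum_(p | f p.1 p.2 == c) transition w a1 p.1 * transition w a2 p.2 =
  Z w * (Z w * (f None None == c)%:R + (1 - Z w) * (f None (Some a2) == c)%:R) +
  (1 - Z w) * (Z w * (f (Some a1) None == c)%:R
               + (1 - Z w) * (f (Some a1) (Some a2) == c)%:R).
Proof.
rewrite -(sum_transition w a2 (fun o => (f None o == c)%:R)).
rewrite -(sum_transition w a2 (fun o => (f (Some a1) o == c)%:R)).
rewrite -(sum_transition w a1
  (fun o' => \sum_o transition w a2 o * (f o' o == c)%:R)).
under [RHS]eq_bigr do rewrite big_distrr.
rewrite pair_bigA /= big_mkcond; apply: eq_bigr => p _ /=.
by case: eqP => _; rewrite ?mulr1 ?mulr0.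
Qed.

(** Since [(u + v) - v = u], the difference is [u] when both symbols arrive and an erasure
    otherwise. *)
Lemma flat_transition (R : realType) (w : bec R) u v c :
  \sum_(p | erased_sub p.1 p.2 == c)
    transition w (u + v) p.1 * transition w v p.2 = transition (flat w) u c.
Proof.
rewrite sum_transition2 transitionE {4}/erased_sub addrK /erased_sub /=; ring.
Qed.

(** Once the correct [u] is subtracted, both symbols are copies of [v], and the result is erased
    only when both are. *)
Lemma sharp_transition (R : realType) (w : bec R) u v c :
  \sum_(p | erased_or (erased_sub p.1 (Some u)) p.2 == c)
    transition w (u + v) p.1 * transition w v p.2 = transition (sharp w) v c.
Proof.
rewrite (sum_transition2 w _ _ (fun o => erased_or (erased_sub o (Some u)))).
rewrite transitionE /erased_sub addrAC subrr add0r /=; ring.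
Qed.

(** The pairs of symbols at different coordinates are independent, so a coordinatewise identity of
    laws lifts to words. [f] depends on [i] because the second child subtracts the [i]-th symbol of
    a fixed word. *)
Lemma prob_combine (R : realType) (w w' : bec R) m (x1 x2 x : 'rV['F_2]_m)
    (f : 'I_m -> option 'F_2 -> option 'F_2 -> option 'F_2)
    (E : pred 'rV[option 'F_2]_m) :
  (forall i c, \sum_(p | f i p.1 p.2 == c)
     transition w (x1 0 i) p.1 * transition w (x2 0 i) p.2
     = transition w' (x 0 i) c) ->
  prob w (row_mx x1 x2)
    (fun y => E (\row_i f i (lsubmx y 0 i) (rsubmx y 0 i))) = prob w' x E.
Proof.
move=> fE; rewrite /prob.
(* Group the received words by their combined word [s]. *)
rewrite (partition_big (fun y : 'rV_(m + m) =>
  \row_i f i (lsubmx y 0 i) (rsubmx y 0 i)) E) //=.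
apply: eq_bigr => s Es.
under [RHS]eq_bigr do rewrite -fE.
rewrite bigA_distr_big_dep /=.
(* Expanding the product of sums gives families of pairs; [h] identifies them with words of double
   length. *)
pose h (g : {ffun 'I_m -> option 'F_2 * option 'F_2}) : 'rV[option 'F_2]_(m + m) :=
  row_mx (\row_i (g i).1) (\row_i (g i).2).
rewrite (reindex h) /=; last first.
  exists (fun y => [ffun i => (lsubmx y 0 i, rsubmx y 0 i)]) => [g _|y _].
    by apply/ffunP => i; rewrite ffunE row_mxKl row_mxKr !mxE -surjective_pairing.
  rewrite -[RHS]hsubmxK; congr row_mx; apply/rowP => i; rewrite !mxE ffunE /=;
  by rewrite mxE.
apply: eq_big => [g|g _].
  rewrite andb_idl ?row_mxKl ?row_mxKr; last by move=> /eqP->.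
  apply/eqP/familyP => [<- i|gs]; first by rewrite /in_mem /= !mxE.
  by apply/rowP => i; have := gs i; rewrite /in_mem /= !mxE => /eqP.
rewrite big_split_ord /= -big_split /=; apply: eq_bigr => i _.
by rewrite !row_mxEl !row_mxEr !mxE.
Qed.

(** * Bounds on the probability of events *)

Lemma prob_le (R : realType) (w : bec R) m (x : 'rV['F_2]_m)
    (E F : pred 'rV[option 'F_2]_m) :
  (forall y, E y -> F y) -> prob w x E <= prob w x F.
Proof.
move=> EF; rewrite /prob big_mkcond [leRHS]big_mkcond.
apply: ler_sum => y _; case: ifP => [/EF->//|_]; case: ifP => // _.
by apply: prodr_ge0 => i _; exact: transition_ge0.
Qed.

Lemma prob_union (R : realType) (w : bec R) m (x : 'rV['F_2]_m)
    (E F : pred 'rV[option 'F_2]_m) :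
  prob w x (fun y => E y || F y) <= prob w x E + prob w x F.
Proof.
rewrite /prob [leLHS]big_mkcond [X in X + _]big_mkcond [X in _ + X]big_mkcond -big_split /=.
apply: ler_sum => y _.
have : 0 <= \prod_i transition w (x 0 i) (y 0 i).
  by apply: prodr_ge0 => i _; exact: transition_ge0.
by case: (E y); case: (F y) => /=; rewrite ?addr0 ?add0r ?lerDl.
Qed.

Lemma prob_true (R : realType) (w : bec R) m (x : 'rV['F_2]_m) :
  prob w x predT = 1.
Proof.
have E1 : \prod_(i < m) \sum_o transition w (x 0 i) o = 1.
  apply: big1 => i _.
  have := sum_transition w (x 0 i) (fun=> 1); rewrite !mulr1 addrC subrK => <-.
  by apply: eq_bigr => o _; rewrite mulr1.
rewrite -[RHS]E1 bigA_distr_bigA /prob /=.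
rewrite (reindex (fun g : {ffun 'I_m -> option 'F_2} => \row_i g i)) /=.
  by apply: eq_bigr => g _; apply: eq_bigr => i _; rewrite mxE.
exists (fun y : 'rV_m => [ffun i => y 0 i]) => [g _|y _].
  by apply/ffunP => i; rewrite ffunE mxE.
by apply/rowP => i; rewrite mxE ffunE.
Qed.

Lemma bernoulli (R : realType) (z : R) m :
  0 <= z <= 1 -> 1 - (1 - z) ^+ m <= m%:R * z.
Proof.
move=> /andP[z0 z1]; elim: m => [|m IH]; first by rewrite expr0 subrr mul0r.
have -> : 1 - (1 - z) ^+ m.+1 = (1 - (1 - z) ^+ m) + z * (1 - z) ^+ m.
  by rewrite exprS; ring.
rewrite -natr1 mulrDl mul1r lerD // ler_piMr // exprn_ile1 ?subr_ge0 //.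
by rewrite gerBl.
Qed.

(** The complementary event, that the word arrives intact, has probability [(1 - Z w) ^+ m]. *)
Lemma prob_erasure (R : realType) (w : bec R) m (x : 'rV['F_2]_m) :
  prob w x (fun y => y != map_mx Some x) <= m%:R * Z w.
Proof.
have := prob_true w x; rewrite /prob (bigD1 (map_mx Some x)) //=.
have -> : \prod_i transition w (x 0 i) (map_mx Some x 0 i) = (1 - Z w) ^+ m.
  under eq_bigr do rewrite mxE /= eqxx mulr1n.
  by rewrite prodr_const card_ord.
move=> /(canRL (addKr _)) ->; rewrite addrC.
exact: bernoulli (Z01 w).
Qed.

(** * Decoding with a genie *)

(* The failure of the decoder that is told the correct word at each first
   child: its input at every vertex is the output of independent uses of the
   channel at this vertex. *)
Fixpoint genie_error (R : realType) (t : tree R) (k : nat) (A : pred vertex)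
    (b : message) : pred (word (option 'F_2) k) :=
  match t with
  | Leaf _ => fun y => A [::] && (y != map_mx Some (\row_i b [::] i))
  | Node _ l r =>
    match k return pred (word (option 'F_2) k) with
    | 0%N => fun=> true
    | k'.+1 => fun y =>
      let y1 := lsubmx y in
      let y2 := rsubmx y in
      let u := encode l k' (below false A) (below false b) in
      genie_error l (below false A) (below false b) (map2_mx erased_sub y1 y2)
      || genie_error r (below true A) (below true b)
           (map2_mx erased_or (map2_mx erased_sub y1 (map_mx Some u)) y2)
    end
  end.

(** By induction the true decoder returns the correct [u] at the first child, so it passes to the
    second child the same input as the genie does. *)
Lemma decode_correct (R : realType) (t : tree R) k (A : pred vertex)
    (b : message) (y : word (option 'F_2) k) :
  (depth t <= k)%N -> ~~ genie_error t A b y ->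
  exists2 b', decode t A y = Some (b', encode t k A b) &
    forall p i, p \in leaves t -> A p -> (i < 2 ^ (k - size p))%N ->
      b' p i = b p i.
Proof.
elim: t k A b y => [w|w l IHl r IHr] k A b y /=.
  move=> _; case: ifP => [_ /negPn/eqP-> | A0 _]; last first.
    by exists (fun=> fun=> 0) => // p i; rewrite inE => /eqP->; rewrite A0.
  set x := \row_i b [::] i.
  have -> : [exists i, map_mx Some x 0 i == None] = false.
    by apply/negbTE/negP => /existsP[i]; rewrite !mxE.
  have -> : map_mx (odflt 0) (map_mx Some x) = x.
    by apply/rowP => i; rewrite !mxE.
  eexists; first by [].
  move=> p i; rewrite inE => /eqP-> _; rewrite subn0 -pow2E => ik.
  (* The bound on [i] keeps [insub] away from the default bit [0]. *)
  by rewrite insubT /= mxE.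
case: k y => // k y; rewrite ltnS geq_max => /andP[lk rk].
rewrite negb_or => /andP[gl gr].
have [bu -> buE] := IHl _ _ _ _ lk gl; have [bv -> bvE] := IHr _ _ _ _ rk gr.
eexists; first by [].
move=> p i; rewrite mem_cat => /orP[] /mapP[q ql ->] Aq; rewrite subSS => iq.
  exact: buE.
exact: bvE.
Qed.

(** A union bound charging [d] per copy: [pow2 k] counts the copies below the vertex, and each child
    receives half of them. *)
Lemma prob_genie_error (R : realType) (d : R) (t : tree R) k (A : pred vertex)
    (b : message) :
  0 <= d -> channel_tree t -> (depth t <= k)%N ->
  (forall p, p \in leaves t -> A p -> Z (label t p) <= d) ->
  prob (Defs.root t) (encode t k A b) (genie_error t A b) <= (pow2 k)%:R * d.
Proof.
move=> d0; elim: t k A b => [w|w l IHl r IHr] k A b /=.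
  move=> _ _ /(_ [::]); rewrite inE eqxx => /(_ isT) Zd.
  case: ifP Zd => [A0 /(_ isT) Zd|A0 _]; last first.
    by rewrite /prob big_pred0 // mulr_ge0.
  by apply: le_trans (prob_erasure _ _) _; rewrite ler_wpM2l.
move=> [rl rr cl cr]; case: k => // k; rewrite ltnS geq_max => /andP[lk rk] Zd.
have Zl p : p \in leaves l -> below false A p -> Z (label l p) <= d.
  by move=> pl; apply: Zd; rewrite mem_cat map_f.
have Zr p : p \in leaves r -> below true A p -> Z (label r p) <= d.
  by move=> pr; apply: Zd; rewrite mem_cat map_f ?orbT.
have {IHl Zl} := IHl k (below false A) (below false b) cl lk Zl.
have {IHr Zr} := IHr k (below true A) (below true b) cr rk Zr.
set u := encode l _ _ _; set v := encode r _ _ _; rewrite rl rr => Pr Pl.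
rewrite /= natrD mulrDl.
apply: le_trans (prob_union _ _ _ _) (lerD _ _).
  apply: le_trans Pl.
  (* The first child sees [u] sent over independent uses of [flat w]. *)
  rewrite -(@prob_combine _ w _ _ (u + v) v u (fun=> erased_sub)).
    by apply: prob_le => y; congr (genie_error _ _ _ _); apply/rowP => i; rewrite !mxE.
  by move=> i c; rewrite mxE flat_transition.
apply: le_trans Pr.
(* With [u] known, the second child sees [v] sent over [sharp w]. *)
rewrite -(@prob_combine _ w _ _ (u + v) v v
   (fun i a1 a2 => erased_or (erased_sub a1 (Some (u 0 i))) a2)).
  by apply: prob_le => y; congr (genie_error _ _ _ _); apply/rowP => i; rewrite !mxE.
by move=> i c; rewrite mxE sharp_transition.
Qed.

Lemma depth_le (R : realType) (t : tree R) n :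
  (forall p, p \in vertices t -> p \notin leaves t -> (size p < n)%N) ->
  (depth t <= n)%N.
Proof.
elim: t n => [//|w l IHl r IHr] n /= sz.
have n0 : (0 < n)%N.
  apply: (sz [::]); first by rewrite inE.
  by rewrite mem_cat; apply/norP; split; apply/mapP => -[].
rewrite -(prednK n0) ltnS geq_max; apply/andP; split.
  apply: IHl => p pv pl; rewrite -ltnS prednK //; apply: (sz (false :: p)).
    by rewrite inE mem_cons_map.
  by rewrite mem_cons_map.
apply: IHr => p pv pl; rewrite -ltnS prednK //; apply: (sz (true :: p)).
  by rewrite inE mem_cons_map.
by rewrite mem_cons_map.
Qed.

Theorem proposition7 (R : realType) (W : bec R) (eps : R) (n : nat)
    (T : tree R) (A : pred vertex) (b : message)
    (eps01 : 0 < eps < 1)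
    (n_gt0 : (0 < n)%N)
    (nE : n%:R = - 5 * (ln eps / ln 2))
    (genT : generated_from W
      (fun d w => (d < n)%N && (eps * 2 ^- n < Y w)) T)
    (AE : forall w, A w = (w \in leaves T) && (Z (label T w) <= eps * 2 ^- n)) :
  block_error_prob T A b <= eps.
Proof.
have [cT _ vT] := genT; have /andP[e0 _] := eps01.
have d0 : 0 <= eps * 2 ^- n by rewrite mulr_ge0 ?invr_ge0 ?exprn_ge0 // ltW.
have depthT : (depth T <= n)%N.
  by apply: depth_le => p pT; rewrite vT // => /andP[].
apply: (@le_trans _ _ ((pow2 (depth T))%:R * (eps * 2 ^- n))); last first.
  (* The number of copies, [2 ^ depth T], is at most [2 ^ n], which cancels the factor [2 ^- n]. *)
  rewrite mulrCA ger_pMr // ler_pdivrMr ?exprn_gt0 // mul1r pow2E natrX.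
  by rewrite ler_weXn2l // ler1n.
apply: le_trans (@prob_genie_error _ _ T _ A b d0 cT (leqnn _) _); last first.
  by move=> p _; rewrite AE => /andP[].
(* Every block error is a genie error: where the genie succeeds, the true decoder recovers all
   bits. *)
apply: prob_le => y; apply: contraLR => /decode_correct[//|b' dE bE].
rewrite /block_error dE; apply/hasPn => p pT; apply/negP => /andP[Ap].
by move=> /existsP[i]; rewrite bE ?eqxx.
Qed.
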